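(* Let $N=2D+1$. Consider the lattice Boltzmann scheme given by $$f_n(\mathbf{x}+\mathbf{v}_n\Delta t,\,t+\Delta t)=(1-\omega)f_n(\mathbf{x},t)+\omega f_n^{eq}(u(\mathbf{x},t)),\qquad 1\le n\le N,$$ with the discrete velocities $\mathbf{v}_n$ and the flux decomposed equilibrium distribution functions $f_n^{eq}$ given in the context. Suppose that it satisfies the definition of conserved moment $\sum_{n=1}^N f_n=\sum_{n=1}^N f_n^{eq}=u$ and the perturbation expansion $f_n=f_n^{eq}+f_n^{neq}$, where $f_n^{neq}=\xi f_n^{(1)}+\xi^2 f_n^{(2)}+\cdots$. Then the scheme corresponds, up to $O(\Delta t^2)$, to the macroscopic scheme $$\begin{aligned}u(x_1,..,x_d,..,x_D,t+\Delta t)=\;&u(x_1,..,x_d,..,x_D,t)\\&-\sum_{d=1}^D\frac{\Delta t}{\Delta x_d}\Big(g_d^{+}(x_1,..,x_d,..,x_D,t)-g_d^{+}(x_1,..,x_{d-1},x_d-\Delta x_d,x_{d+1},..,x_D,t)\Big)\\&+\sum_{d=1}^D\frac{\Delta t}{\Delta x_d}\Big(g_d^{-}(x_1,..,x_{d-1},x_d+\Delta x_d,x_{d+1},..,x_D,t)-g_d^{-}(x_1,..,x_d,..,x_D,t)\Big),\end{aligned}$$ that is, $u(\mathbf{x},t+\Delta t)$ equals the right-hand side plus $O(\Delta t^2)$. Here $g_d^{\pm}(\mathbf{x},t)$ denotes $g_d(u(\mathbf{x},t))^{\pm}$.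
   Context: Setting: a hyperbolic scalar conservation law $\partial_t u+\sum_{d=1}^D\partial_{x_d}g_d(u)=0$ with $u:\mathbb{R}^D\times[0,T]\to\mathcal{U}\subseteq\mathbb{R}$ and flux functions $g_d:\mathcal{U}\to\mathbb{R}$. Flux splitting: the wave speeds $a_d(u)=\partial_u g_d(u)$ are decomposed as $a_d=a_d^+-a_d^-$, where $a_d(u)^+=a_d(u)$ and $a_d(u)^-=0$ if $a_d(u)\ge 0$, while $a_d(u)^+=0$ and $a_d(u)^-=-a_d(u)$ if $a_d(u)<0$. The corresponding fluxes are $g_d(u)^{\pm}=\int_0^u a_d(s)^{\pm}\,ds$. Discrete velocities: $\mathbf{v}_n=(v_n^{(1)},\dots,v_n^{(D)})$ with $v_n^{(d)}=\lambda_d\delta_{nd}$ if $1\le n\le D$; $v_{D+1}^{(d)}=0$; $v_n^{(d)}=-\lambda_{n-(D+1)}\delta_{d,n-(D+1)}$ if $D+2\le n\le 2D+1$. Here $\delta$ is the Kronecker delta and $\lambda_d=\Delta x_d/\Delta t>0$, where $\Delta x_d$ is the mesh size in direction $d$ of a structured mesh and $\Delta t$ is the time step. Equilibria: $f_n^{eq}(u)=g_n(u)^+/\lambda_n$ for $1\le n\le D$; $f_{D+1}^{eq}(u)=u-\sum_{d=1}^D\frac{g_d(u)^++g_d(u)^-}{\lambda_d}$; $f_n^{eq}(u)=g_{n-(D+1)}(u)^-/\lambda_{n-(D+1)}$ for $D+2\le n\le 2D+1$. Scaling: $\epsilon>0$ is the relaxation time and $\omega=\Delta t/\epsilon$. Both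 $\epsilon$ and the expansion parameter $\xi$ are of the order of the Knudsen number. The parameter $\omega$ is taken in $0<\omega<2$, and can be chosen between $1$ and $2$, so that $1/\omega=O(1)$. Perturbation expansion: it is the formal Chapman-Enskog expansion, used with the multiple scale expansions $\partial_t f_n=(\xi\partial_t^{(1)}+\xi^2\partial_t^{(2)}+\cdots)f_n$ and $v_n^{(d)}\partial_{x_d}f_n=\xi v_n^{(d)}\partial_{x_d}^{(1)}f_n$ in the Taylor expanded lattice Boltzmann equation, terms being separated according to powers of $\xi$. Since the collision operator preserves the conserved moment, $\sum_{n=1}^N f_n^{(i)}=0$ for every $i\in\mathbb{N}$. Orders of magnitude are understood in the sense of this formal expansion. *)

(* Defs.v *)
From mathcomp Require Import all_boot all_order all_algebra.
From mathcomp Require Import all_classical all_reals all_analysis.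

Set Implicit Arguments.
Unset Strict Implicit.
Unset Printing Implicit Defensive.

Import Order.TTheory GRing.Theory Num.Theory.
Import numFieldNormedType.Exports.

Local Open Scope classical_set_scope.
Local Open Scope ring_scope.

Section flux_splitting.
Variable R : realType.

Definition wave_speed (g : R -> R) : R -> R := derive1 g.

Definition speed_plus (g : R -> R) (s : R) : R :=
  if 0 <= wave_speed g s then wave_speed g s else 0.

Definition speed_minus (g : R -> R) (s : R) : R :=
  if 0 <= wave_speed g s then 0 else - wave_speed g s.

(* The signed integral: \int_0^u = - \int_u^0 for u < 0. *)
Definition int0 (F : R -> R) (u : R) : R :=
  if 0 <= u then \int[lebesgue_measure]_(s in `[0, u]) F s
  else - \int[lebesgue_measure]_(s in `[u, 0]) F s.

Definition flux_plus (g : R -> R) (u : R) : R := int0 (speed_plus g) u.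
Definition flux_minus (g : R -> R) (u : R) : R := int0 (speed_minus g) u.

(* A flux on the state space U is a total function, whose values outside U are
   irrelevant.  These conditions are what the split fluxes need in order to be
   defined on U: [0, u] is contained in U and g' is integrable on it. *)
Definition admissible_flux (U : set R) (g : R -> R) : Prop :=
  [/\ is_interval U, U 0,
      forall s, U° s -> derivable g s 1
    & forall a b, U a -> U b ->
        lebesgue_measure.-integrable `[a, b] (EFin \o wave_speed g)].

End flux_splitting.

Section lattice_boltzmann.
Variables (R : realType) (D : nat).

(* 2D + 1 velocities, laid out in three consecutive blocks of sizes D, 1, D:
   n = lshift _ d           is the velocity   lambda_d e_d,
   n = rshift D ord0        is the velocity   0,
   n = rshift D (rshift 1 d) is the velocity - lambda_d e_d. *)
Definition nvel : nat := (D + (1 + D))%N.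

Definition unit_vec (d : 'I_D) : 'rV[R]_D := delta_mx 0 d.

Definition velocity (lambda : 'I_D -> R) (n : 'I_nvel) : 'rV[R]_D :=
  match fintype.split n with
  | inl d => lambda d *: unit_vec d
  | inr m => match fintype.split m with
             | inl _ => 0
             | inr d => - lambda d *: unit_vec d
             end
  end.

Definition feq (lambda : 'I_D -> R) (g : 'I_D -> R -> R) (n : 'I_nvel) (u : R)
    : R :=
  match fintype.split n with
  | inl d => flux_plus (g d) u / lambda d
  | inr m =>
      match fintype.split m with
      | inl _ =>
          u - \sum_(d < D) (flux_plus (g d) u + flux_minus (g d) u) / lambda d
      | inr d => flux_minus (g d) u / lambda d
      end
  end.

Definition lbm_scheme (lambda : 'I_D -> R) (g : 'I_D -> R -> R) (T dt omega : R)
    (f : 'I_nvel -> 'rV[R]_D -> R -> R) (u : 'rV[R]_D -> R -> R) : Prop :=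
  forall (n : 'I_nvel) (x : 'rV[R]_D) (t : R), 0 <= t -> t + dt <= T ->
    f n (x + dt *: velocity lambda n) (t + dt) =
    (1 - omega) * f n x t + omega * feq lambda g n (u x t).

Definition conserved_moment (lambda : 'I_D -> R) (g : 'I_D -> R -> R) (T : R)
    (f : 'I_nvel -> 'rV[R]_D -> R -> R) (u : 'rV[R]_D -> R -> R) : Prop :=
  forall (x : 'rV[R]_D) (t : R), 0 <= t <= T ->
    \sum_n f n x t = u x t /\ \sum_n feq lambda g n (u x t) = u x t.

Definition macro_step (dx : 'I_D -> R) (g : 'I_D -> R -> R) (dt : R)
    (u : 'rV[R]_D -> R -> R) (x : 'rV[R]_D) (t : R) : R :=
  u x t
  - \sum_(d < D) dt / dx d *
      (flux_plus (g d) (u x t) - flux_plus (g d) (u (x - dx d *: unit_vec d) t))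
  + \sum_(d < D) dt / dx d *
      (flux_minus (g d) (u (x + dx d *: unit_vec d) t)
       - flux_minus (g d) (u x t)).

(* F dt x t = O(G dt) as dt -> 0+, uniformly over bounded sets of positions x
   and over the times t in S dt. *)
Definition unifO (S : R -> set R) (F : R -> 'rV[R]_D -> R -> R) (G : R -> R)
    : Prop :=
  forall r : R, exists C : R, \forall dt \near 0^'+,
    forall (x : 'rV[R]_D) (t : R), `|x| <= r -> S dt t ->
      `|F dt x t| <= C * `|G dt|.

(* fneq = xi f^(1) + xi^2 f^(2) + ... as an asymptotic expansion: all partial
   sums are accurate to the first omitted order, and the coefficients and their
   spatial derivatives are of order one.  As in the Chapman-Enskog procedure,
   where they are functionals of u, the coefficients fi i may depend on dt. *)
Definition perturbation_expansion (T : R) (xi : R -> R)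
    (fneq : R -> 'I_nvel -> 'rV[R]_D -> R -> R)
    (fi : nat -> R -> 'I_nvel -> 'rV[R]_D -> R -> R) : Prop :=
  [/\ forall (n : 'I_nvel) (K : nat),
        unifO (fun=> `[0, T]%classic)
          (fun dt x t => fneq dt n x t
             - \sum_(1 <= i < K.+1) xi dt ^+ i * fi i dt n x t)
          (fun dt => xi dt ^+ K.+1),
      forall (i : nat) (n : 'I_nvel), (0 < i)%N ->
        unifO (fun=> `[0, T]%classic) (fun dt => fi i dt n) (fun=> 1),
      forall (i : nat) (n : 'I_nvel) (d : 'I_D), (0 < i)%N ->
        \forall dt \near 0^'+, forall (x : 'rV[R]_D) (t : R), 0 <= t <= T ->
          derivable (fun y => fi i dt n y t) x (unit_vec d)
    & forall (i : nat) (n : 'I_nvel) (d : 'I_D), (0 < i)%N ->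
        unifO (fun=> `[0, T]%classic)
          (fun dt x t => 'D_(unit_vec d) (fun y => fi i dt n y t) x) (fun=> 1)].

End lattice_boltzmann.

(* Main.v *)
Require Import Defs.
From mathcomp Require Import all_boot all_order all_algebra.
From mathcomp Require Import all_classical all_reals all_analysis.
From mathcomp Require Import ring lra.
Import Order.TTheory GRing.Theory Num.Theory.
Import numFieldNormedType.Exports.
Local Open Scope classical_set_scope.
Local Open Scope ring_scope.

(** Summing the scheme over the velocities, at the points from which the
    populations stream towards [x], gives the identity
      [u(x, t + dt) = sum_n feq_n(u(x - dt v_n, t))
                      + (1 - omega) sum_n fneq_n(x - dt v_n, t)].

    The first sum is the macroscopic scheme exactly, not only up to an error:
    the velocity [lambda_d e_d] moves a population by one mesh size
    [dx_d = lambda_d dt], so each split flux is evaluated at its upwind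
    neighbour, and [dt / dx_d = 1 / lambda_d] is the factor of the equilibria
    ([sum_feq_streamed]).

    The second sum is the defect.  By conservation [sum_n fneq_n(x, t) = 0],
    hence the defect is
      [(1 - omega) sum_n (fneq_n(x - dt v_n, t) - fneq_n(x, t))]
    ([macro_step_defect]).  Two smallness effects now multiply: with
    [fneq_n = xi f_n^(1) + O(xi^2)], the first-order term contributes [xi] times
    the increment of [f_n^(1)] over a displacement of length [O(dt)], which is
    [O(dt)] by the mean value theorem since the space derivatives of [f_n^(1)]
    are of order one ([unifO_streaming_increment]); the remainder is [O(xi^2)].
    As [xi = O(eps)] and [eps = dt / omega] with [1 / omega = O(1)], the
    parameter [xi] is [O(dt)] ([expansion_parameter_le]), so that the defect is
    [O(dt^2)]. *)

(** * Calculus of uniform orders of magnitude *)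

Section uniform_order.
Context {R : realType} {D : nat}.
Implicit Types (S : R -> set R) (F : R -> 'rV[R]_D -> R -> R) (G : R -> R).

Lemma near_unifO S F F' G :
  (\forall dt \near 0^'+, forall x t, S dt t -> F dt x t = F' dt x t) ->
  unifO S F' G -> unifO S F G.
Proof.
move=> FF' F'G r; have [C F'C] := F'G r; exists C.
near=> dt => x t xr St.
rewrite (_ : F dt x t = F' dt x t).
  by move: t St x xr; near: dt; apply: filterS F'C => dt H t St x xr; exact: H.
by move: t St x xr; near: dt; apply: filterS FF' => dt H t St x xr; exact: H.
Unshelve. all: by end_near. Qed.

Lemma unifO_subset S S' F G :
  (\forall dt \near 0^'+, S' dt `<=` S dt) -> unifO S F G -> unifO S' F G.
Proof.
move=> SS' FG r; have [C FC] := FG r; exists C.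
by apply: filterS2 SS' FC => dt sub bnd x t xr /sub; exact: bnd.
Qed.

Lemma unifO_trans S F G G' (C : R) :
  (\forall dt \near 0^'+, `|G dt| <= C * `|G' dt|) ->
  unifO S F G -> unifO S F G'.
Proof.
move=> GG' FG r; have [C1 FC] := FG r; exists (`|C1| * C).
apply: filterS2 GG' FC => dt leG bnd x t xr St.
apply: le_trans (bnd x t xr St) _; rewrite -mulrA.
apply: le_trans (ler_wpM2r (normr_ge0 _) (ler_norm C1)) _.
exact: ler_wpM2l.
Qed.

Lemma unifO0 S G : unifO S (fun _ (_ : 'rV[R]_D) _ => 0) G.
Proof.
by move=> r; exists 0; near=> dt => x t _ _; rewrite normr0 mul0r.
Unshelve. all: by end_near. Qed.

Lemma unifOD S F F' G : unifO S F G -> unifO S F' G ->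
  unifO S (fun dt x t => F dt x t + F' dt x t) G.
Proof.
move=> FG F'G r; have [C FC] := FG r; have [C' F'C] := F'G r.
exists (C + C'); apply: filterS2 FC F'C => dt bnd bnd' x t xr St.
apply: le_trans (ler_normD _ _) _; rewrite mulrDl.
by apply: lerD; [exact: bnd|exact: bnd'].
Qed.

Lemma unifOM S F F' G G' : unifO S F G -> unifO S F' G' ->
  unifO S (fun dt x t => F dt x t * F' dt x t) (fun dt => G dt * G' dt).
Proof.
move=> FG F'G r; have [C FC] := FG r; have [C' F'C] := F'G r.
exists (C * C'); apply: filterS2 FC F'C => dt bnd bnd' x t xr St.
by rewrite !normrM mulrACA ler_pM // ?bnd ?bnd'.
Qed.

Lemma unifON S F G : unifO S F G -> unifO S (fun dt x t => - F dt x t) G.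
Proof.
move=> FG r; have [C FC] := FG r; exists C.
by apply: filterS FC => dt bnd x t xr St; rewrite normrN bnd.
Qed.

Lemma unifO_sum (I : finType) S (F : I -> R -> 'rV[R]_D -> R -> R) G :
  (forall i, unifO S (F i) G) ->
  unifO S (fun dt x t => \sum_i F i dt x t) G.
Proof.
move=> FG; elim: (index_enum I) => [|i s IHs].
  by apply: near_unifO (unifO0 S G); near=> dt => x t _; rewrite big_nil.
apply: near_unifO (unifOD _ _ _ _ (FG i) IHs).
by near=> dt => x t _; rewrite big_cons.
Unshelve. all: by end_near. Qed.

Lemma unifO_scalar S (c G : R -> R) (C : R) :
  (\forall dt \near 0^'+, `|c dt| <= C * `|G dt|) ->
  unifO S (fun dt (_ : 'rV[R]_D) _ => c dt) G.
Proof.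
by move=> cG r; exists C; apply: filterS cG => dt bnd x t _ _.
Qed.

(** Once [dt <= 1] the displacement is at most [`|c|], so the enlarged radius
    does not depend on [dt]. *)
Lemma ball_near_shift (c : 'rV[R]_D) (r : R) :
  \forall dt \near 0^'+, forall x : 'rV[R]_D,
    `|x| <= r -> `|x - dt *: c| <= r + `|c|.
Proof.
near=> dt => x xr; apply: le_trans (ler_normB _ _) _.
rewrite lerD// normrZ ger0_norm//.
by rewrite ler_piMl//; near: dt; exact: nbhs_right_le.
Unshelve. all: by end_near. Qed.

(** The bounds of [unifO] hold on every ball, so a displacement of the argument
    costs only a larger radius. *)
Lemma unifO_shift S F G (c : 'rV[R]_D) :
  unifO S F G -> unifO S (fun dt x t => F dt (x - dt *: c) t) G.
Proof.
move=> FG r; have [C FC] := FG (r + `|c|); exists C.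
apply: filterS2 (ball_near_shift c r) FC => dt xc bnd x t xr St.
by apply: bnd => //; exact: xc.
Qed.

End uniform_order.

(** * Increments along a line *)

(** The mean value theorem for [s |-> h (x + s v)], whose derivative is the
    directional derivative of [h]; differentiability of [h] in the single
    direction [v] is enough. *)
Lemma norm_increment_le {R : realType} {V : normedModType R} (h : V -> R)
    (x v : V) (a C : R) :
  (forall s : R, `|s| <= `|a| ->
     derivable h (x + s *: v) v /\ `|'D_v h (x + s *: v)| <= C) ->
  `|h (x + a *: v) - h x| <= C * `|a|.
Proof.
move=> hC; pose phi (s : R) := h (x + s *: v).
have dphi (s : R) : `|s| <= `|a| -> is_derive s 1 phi ('D_v h (x + s *: v)).
  move=> /hC[+ _]; rewrite /derivable /derive => hv.
  have E : (fun k : R => k^-1 *: ((phi \o shift s) (k *: (1 : R)) - phi s)) =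
           (fun k => k^-1 *: ((h \o shift (x + s *: v)) (k *: v)
                              - h (x + s *: v))).
    apply/funext => k; rewrite /phi /= [k *: (1 : R)]mulr1.
    by rewrite scalerDl addrCA.
  by split; rewrite /derivable /derive E.
have key p q : p <= q -> `|p| <= `|a| -> `|q| <= `|a| ->
    `|phi q - phi p| <= C * (q - p).
  move=> pq pa qa.
  have ina s : s \in `[p, q] -> `|s| <= `|a|.
    rewrite in_itv /= => /andP[ps sq].
    by move: pa qa; rewrite !ler_norml => /andP[? ?] /andP[? ?]; lra.
  have [s sin ->] : exists2 s, s \in `[p, q] &
      phi q - phi p = 'D_v h (x + s *: v) * (q - p).
    apply: MVT_segment => // [s /subset_itv_oo_cc/ina|]; first exact: dphi.
    apply: derivable_within_continuous => s /ina/dphi ds.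
    exact: ex_derive.
  have [_ bnd] := hC s (ina s sin).
  by rewrite normrM [X in _ * X]ger0_norm ?subr_ge0// ler_wpM2r ?subr_ge0.
have phi0 : phi 0 = h x by rewrite /phi scale0r addr0.
rewrite -phi0 -/(phi a); have [a0|/ltW a0] := leP 0 a.
  by have := key 0 a a0; rewrite normr0 subr0 ger0_norm//; apply.
by have := key a 0 a0; rewrite normr0 distrC sub0r ler0_norm//; apply; rewrite ?oppr_ge0.
Qed.

(** * One step of the lattice Boltzmann scheme *)

Section lattice_boltzmann_step.
Context {R : realType} {D : nat}.
Implicit Types (lambda : 'I_D -> R) (g : 'I_D -> R -> R).

Lemma velocity_plus lambda d :
  velocity lambda (lshift (1 + D) d) = lambda d *: unit_vec R d.
Proof. by rewrite /velocity (unsplitK (inl d)). Qed.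

Lemma velocity_rest lambda m : velocity lambda (rshift D (lshift D m)) = 0.
Proof. by rewrite /velocity (unsplitK (inr _)) (unsplitK (inl m)). Qed.

Lemma velocity_minus lambda d :
  velocity lambda (rshift D (rshift 1 d)) = - lambda d *: unit_vec R d.
Proof. by rewrite /velocity (unsplitK (inr _)) (unsplitK (inr d)). Qed.

(** Every discrete velocity is parallel to a coordinate axis, which is why
    partial derivatives along the axes control all streaming increments. *)
Lemma velocity_axis lambda n :
  velocity lambda n = 0 \/
  exists d c, velocity lambda n = c *: unit_vec R d.
Proof.
rewrite /velocity; case: fintype.split => [d|m]; first by right; exists d, (lambda d).
by case: fintype.split => [_|d]; [left|right; exists d, (- lambda d)].
Qed.

Lemma upstream_plus lambda (dt : R) x d :
  x - dt *: velocity lambda (lshift (1 + D) d) =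
  x - (lambda d * dt) *: unit_vec R d.
Proof. by rewrite velocity_plus scalerA [dt * _]mulrC. Qed.

Lemma upstream_minus lambda (dt : R) x d :
  x - dt *: velocity lambda (rshift D (rshift 1 d)) =
  x + (lambda d * dt) *: unit_vec R d.
Proof.
by rewrite velocity_minus scalerA mulrN scaleNr opprK [dt * _]mulrC.
Qed.

Lemma feq_plus lambda g d v :
  feq lambda g (lshift (1 + D) d) v = flux_plus (g d) v / lambda d.
Proof. by rewrite /feq (unsplitK (inl d)). Qed.

Lemma feq_rest lambda g m v :
  feq lambda g (rshift D (lshift D m)) v =
  v - \sum_(d < D) (flux_plus (g d) v + flux_minus (g d) v) / lambda d.
Proof. by rewrite /feq (unsplitK (inr _)) (unsplitK (inl m)). Qed.

Lemma feq_minus lambda g d v :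
  feq lambda g (rshift D (rshift 1 d)) v = flux_minus (g d) v / lambda d.
Proof. by rewrite /feq (unsplitK (inr _)) (unsplitK (inr d)). Qed.

(** Streaming the equilibria is upwinding: [flux_plus] travels with
    [+ lambda_d e_d] and so comes from [x - dx_d e_d], [flux_minus] comes from
    [x + dx_d e_d], and the rest population supplies [u] and, for
    each direction, the two fluxes evaluated at [x]. *)
Lemma sum_feq_streamed lambda g (dt : R) (w : 'rV[R]_D -> R -> R) x t :
  dt != 0 ->
  \sum_n feq lambda g n (w (x - dt *: velocity lambda n) t) =
  macro_step (fun d => lambda d * dt) g dt w x t.
Proof.
move=> dt0.
pose up d := w (x - (lambda d * dt) *: unit_vec R d) t.
pose down d := w (x + (lambda d * dt) *: unit_vec R d) t.
transitivity (\sum_d flux_plus (g d) (up d) / lambda d +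
  (w x t
   - \sum_d (flux_plus (g d) (w x t) + flux_minus (g d) (w x t)) / lambda d
   + \sum_d flux_minus (g d) (down d) / lambda d)).
  (* nvel D is D + (1 + D): moving forward, at rest, moving backward. *)
  rewrite (@big_split_ord _ _ _ D (1 + D)) big_split_ord big_ord1.
  congr (_ + (_ + _)).
  - by apply: eq_bigr => d _; rewrite upstream_plus feq_plus.
  - by rewrite velocity_rest feq_rest scaler0 subr0.
  - by apply: eq_bigr => d _; rewrite upstream_minus feq_minus.
(* Both sides are w x t plus a sum over the directions: compare termwise. *)
rewrite /macro_step addrCA -!addrA; congr (_ + _).
rewrite -!sumrN -!big_split /=; apply: eq_bigr => d _.
have -> : dt / (lambda d * dt) = (lambda d)^-1.
  by rewrite invfM mulrCA divff// mulr1.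
ring.
Qed.

(** Only the nonequilibrium parts survive besides [macro_step]; their sum at [x]
    vanishes by conservation, and subtracting it turns the defect into a sum of
    increments, which gains one order in [dt]. *)
Lemma macro_step_defect lambda g (T dt omega : R)
    (f : 'I_(nvel D) -> 'rV[R]_D -> R -> R) (u : 'rV[R]_D -> R -> R) x t :
  0 < dt -> lbm_scheme lambda g T dt omega f u ->
  conserved_moment lambda g T f u -> 0 <= t <= T - dt ->
  let fneq n y := f n y t - feq lambda g n (u y t) in
  u x (t + dt) - macro_step (fun d => lambda d * dt) g dt u x t =
  (1 - omega) * \sum_n (fneq n (x - dt *: velocity lambda n) - fneq n x).
Proof.
move=> dt0 scheme moment /andP[t0 tT] fneq.
(* Conservation is used at the time t + dt, for u, and at t, for fneq. *)
have tdtT : t + dt <= T by lra.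
have [<- _] := moment x (t + dt) ltac:(lra).
have [fu feu] := moment x t ltac:(lra).
have fneq0 : \sum_n fneq n x = 0 by rewrite sumrB fu feu subrr.
rewrite -sum_feq_streamed ?gt_eqF// sumrB fneq0 subr0 -sumrB mulr_sumr.
apply: eq_bigr => n _; rewrite -{1}[x](subrK (dt *: velocity lambda n)).
by rewrite scheme// /fneq; ring.
Qed.

(** A displacement [dt *: v_n] has length [O(dt)]; partial derivatives bounded on
    bounded sets therefore give an increment [O(dt)]. *)
Lemma unifO_streaming_increment lambda n (T : R)
    (h : R -> 'rV[R]_D -> R -> R) :
  (forall d, \forall dt \near 0^'+, forall x t, 0 <= t <= T ->
     derivable (h dt ^~ t) x (unit_vec R d)) ->
  (forall d, unifO (fun=> `[0, T]%classic)
     (fun dt x t => 'D_(unit_vec R d) (h dt ^~ t) x) (fun=> 1)) ->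
  unifO (fun=> `[0, T]%classic)
    (fun dt x t => h dt (x - dt *: velocity lambda n) t - h dt x t) id.
Proof.
move=> hd hD; have [->|[d [c ->]]] := velocity_axis lambda n.
  apply: near_unifO (unifO0 _ _).
  by near=> dt => x t _; rewrite scaler0 subr0 subrr.
set e := unit_vec R d => r.
have [C hC] := hD d (r + `|c *: e|); exists (C * `|c|).
have dt01 : \forall dt \near (0 : R)^'+, 0 < dt <= 1.
  near=> dt; apply/andP; split=> //.
  by near: dt; exact: nbhs_right_le.
apply: filterS3 dt01 (hd d) hC => dt /andP[dt0 dt1] dh bnd x t xr.
rewrite /= in_itv /= => tT.
have -> : x - dt *: (c *: e) = x + (- (dt * c)) *: e.
  by rewrite scalerA scaleNr.
have -> : C * `|c| * `|dt| = C * `|- (dt * c)|.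
  by rewrite normrN normrM; ring.
have := norm_increment_le (h dt ^~ t) x e (- (dt * c)) C; apply.
move=> s sle; split; first exact: dh.
apply: le_trans (bnd _ _ _ _) _; rewrite /= ?in_itv //= ?normr1 ?mulr1//.
apply: le_trans (ler_normD _ _) _; rewrite lerD// !normrZ ler_wpM2r//.
apply: le_trans sle _; rewrite normrN normrM ler_piMl//.
by rewrite ger0_norm// ltW.
Unshelve. all: by end_near. Qed.

End lattice_boltzmann_step.

(** * Order of the defect *)

(** The relaxation relation [eps = dt / omega] makes [eps], and with it [xi], of
    order [dt]. *)
Lemma expansion_parameter_le {R : realType} (eps omega xi : R -> R) :
  (\forall dt \near 0^'+, 0 < eps dt) ->
  (\forall dt \near 0^'+, omega dt = dt / eps dt /\ 0 < omega dt < 2) ->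
  (exists C : R, \forall dt \near 0^'+, (omega dt)^-1 <= C) ->
  (exists c C : R, 0 < c /\
    \forall dt \near 0^'+, c * eps dt <= xi dt <= C * eps dt) ->
  exists K : R, \forall dt \near 0^'+, `|xi dt| <= K * `|dt|.
Proof.
move=> eps_gt0 omegaP [C1 omegaV] [c [C [c0 xiC]]]; exists (C * C1); near=> dt.
have d0 : 0 < dt by [].
have e0 : 0 < eps dt by near: dt.
have [omegaE omega02] : omega dt = dt / eps dt /\ 0 < omega dt < 2 by near: dt.
have [omega0 _] := andP omega02.
have omegaC : (omega dt)^-1 <= C1 by near: dt.
have /andP[cxi xile] : c * eps dt <= xi dt <= C * eps dt by near: dt.
have xi0 : 0 < xi dt by apply: lt_le_trans cxi; rewrite mulr_gt0.
have C0 : 0 < C by rewrite -(pmulr_lgt0 _ e0); exact: lt_le_trans xile.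
have epsE : eps dt = (omega dt)^-1 * dt.
  by rewrite omegaE invfM invrK mulrAC mulVf ?gt_eqF// mul1r.
rewrite !gtr0_norm//; apply: le_trans xile _.
by rewrite -mulrA ler_wpM2l ?(ltW C0)// epsE ler_wpM2r// ltW.
Unshelve. all: by end_near. Qed.

Theorem theorem1 (R : realType) (D : nat) (U : set R) (g : 'I_D -> R -> R)
  (T : R) (lambda : 'I_D -> R) (eps omega xi : R -> R)
  (f : R -> 'I_(nvel D) -> 'rV[R]_D -> R -> R)
  (u : R -> 'rV[R]_D -> R -> R)
  (fi : nat -> R -> 'I_(nvel D) -> 'rV[R]_D -> R -> R)
  (hg : forall d : 'I_D, admissible_flux U (g d))
  (hT : 0 < T)
  (hlambda : forall d : 'I_D, 0 < lambda d)
  (heps : \forall dt \near 0^'+, 0 < eps dt)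
  (homega : \forall dt \near 0^'+, omega dt = dt / eps dt /\ 0 < omega dt < 2)
  (homegaV : exists C : R, \forall dt \near 0^'+, (omega dt)^-1 <= C)
  (hxi : exists c C : R, 0 < c /\
    \forall dt \near 0^'+, c * eps dt <= xi dt <= C * eps dt)
  (hU : \forall dt \near 0^'+, forall (x : 'rV[R]_D) (t : R),
    0 <= t <= T -> U (u dt x t))
  (hscheme : \forall dt \near 0^'+,
    lbm_scheme lambda g T dt (omega dt) (f dt) (u dt))
  (hmoment : \forall dt \near 0^'+,
    conserved_moment lambda g T (f dt) (u dt))
  (hexp : perturbation_expansion T xi
    (fun dt n x t => f dt n x t - feq lambda g n (u dt x t)) fi) :
  unifO (fun dt => `[0, T - dt]%classic)
    (fun dt x t => u dt x (t + dt)
       - macro_step (fun d => lambda d * dt) g dt (u dt) x t)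
    (fun dt => dt ^+ 2).
Proof.
have [expK _ expd expD] := hexp.
have dt_pos : \forall dt \near 0^'+, 0 < dt :> R by near=> dt.
have [K xi_le] := expansion_parameter_le eps omega xi heps homega homegaV hxi.
have one_sub_omega : \forall dt \near 0^'+, `|1 - omega dt| <= 1 * `|1 : R|.
  apply: filterS homega => dt [_ /andP[gt0 lt2]].
  by rewrite normr1 mulr1 ler_norml; lra.
apply: (@near_unifO _ _ _ _ (fun dt x t => (1 - omega dt) * \sum_n
  ((f dt n (x - dt *: velocity lambda n) t
    - feq lambda g n (u dt (x - dt *: velocity lambda n) t))
   - (f dt n x t - feq lambda g n (u dt x t))))).
  apply: filterS3 dt_pos hscheme hmoment => dt dt0 scheme moment x t.
  rewrite /= in_itv /= => tT.
  exact: macro_step_defect scheme moment tT.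
rewrite (_ : (fun dt => dt ^+ 2) = (fun dt : R => 1 * dt ^+ 2)); last first.
  by apply/funext => dt; rewrite mul1r.
apply: unifOM; first exact: unifO_scalar one_sub_omega.
apply: unifO_sum => n.
apply: (unifO_subset (fun=> `[0, T]%classic)).
  apply: filterS dt_pos => dt dt0 t; rewrite /= !in_itv /= => /andP[t0 tT].
  by rewrite t0/=; lra.
(* fneq splits into its first-order term xi f^(1) and a remainder O(xi^2). *)
pose rem dt x t := f dt n x t - feq lambda g n (u dt x t) - xi dt * fi 1 dt n x t.
have remO : unifO (fun=> `[0, T]%classic) rem (fun dt => dt ^+ 2).
  apply: (@unifO_trans _ _ _ _ (fun dt => xi dt ^+ 2) _ (K ^+ 2)).
    apply: filterS xi_le => dt le.
    by rewrite !normrX -exprMn lerXn2r ?nnegrE// (le_trans _ le).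
  apply: near_unifO (expK n 1); near=> dt => x t _.
  by rewrite big_nat1 expr1.
have incrO : unifO (fun=> `[0, T]%classic) (fun dt x t => xi dt *
    (fi 1 dt n (x - dt *: velocity lambda n) t - fi 1 dt n x t))
    (fun dt => dt * dt).
  apply: unifOM; first exact: unifO_scalar xi_le.
  exact: (unifO_streaming_increment lambda n T (fi 1 ^~ n)
    (expd 1 n ^~ isT) (expD 1 n ^~ isT)).
have := unifOD _ _ _ _ (unifOD _ _ _ _ (unifO_shift _ _ _ (velocity lambda n) remO)
  (unifON _ _ _ remO)) incrO.
apply: near_unifO; near=> dt => x t _; rewrite /rem; ring.
Unshelve. all: by end_near. Qed.
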